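(* Let $\mathcal{H},\mathcal{S}$ be reflexive Banach spaces, $\mathcal{U}\subset\mathcal{H}$ and $\mathcal{T}\subset\mathcal{S}$ closed convex nonempty subsets, $\mathcal{B}:\mathcal{H}\times\mathcal{S}\to\mathbb{R}$ a continuous bilinear form, and $\phi:\mathcal{H}\to\mathbb{R}\cup\{+\infty\}$, $\phi^*:\mathcal{S}\to\mathbb{R}\cup\{+\infty\}$ convex, lower semi-continuous and proper functionals such that $$\Psi(\hat U,\hat P)=\phi(\hat U)+\phi^*(\hat P)-\mathcal{B}(\hat U,\hat P)\ge 0\qquad\forall(\hat U,\hat P)\in\mathcal{U}\times\mathcal{T},$$ i.e. $\Psi:\mathcal{U}\times\mathcal{T}\to\mathbb{R}$ is a generalized constitutive relation error. Let $(U,P)\in\mathcal{U}\times\mathcal{T}$ be the exact solution pair, so that $\Psi(U,P)=0$. Then for all $(\hat U,\hat P)\in\mathcal{U}\times\mathcal{T}$, $$\Psi(\hat U,\hat P)=\bar\phi_{(U,P)}(\hat U-U)+\bar\phi^*_{(U,P)}(\hat P-P)-\mathcal{B}(\hat U-U,\hat P-P).$$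
   Context: The function $\Psi$ is called the generalized constitutive relation error (GCRE). The problem under consideration is: find $(U,P)\in\mathcal{H}\times\mathcal{S}$ such that $U\in\mathcal{U}$, $P\in\mathcal{T}$, $\Psi(U,P)=0$; existence and uniqueness of this exact solution pair $(U,P)$ is assumed. The error functionals are $$\bar\phi_{(U,P)}(e)=\phi(U+e)-\phi(U)-\mathcal{B}(e,P),\quad e\in\mathcal{H},$$ $$\bar\phi^*_{(U,P)}(r)=\phi^*(P+r)-\phi^*(P)-\mathcal{B}(U,r),\quad r\in\mathcal{S},$$ with values in $\mathbb{R}\cup\{+\infty\}$. Here $\phi^*$ is just a given functional on $\mathcal{S}$ (the generalized complementary energy functional). *)

(* Defs.v *)
From mathcomp Require Import all_boot all_order all_algebra.
From mathcomp Require Import boolp classical_sets reals ereal convex.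
From mathcomp Require Import topology normedtype.

Set Implicit Arguments.
Unset Strict Implicit.
Unset Printing Implicit Defensive.

Import Order.TTheory GRing.Theory Num.Theory.
Import numFieldNormedType.Exports.

Local Open Scope classical_set_scope.
Local Open Scope ring_scope.

Definition topological_dual (R : realType) (V : normedModType R) :
    set (V -> R) :=
  [set f : V -> R | scalar f /\ continuous f].

(* The supremum is over a nonempty set, which is bounded above for every f in
   the topological dual. *)
Definition dual_norm (R : realType) (V : normedModType R) (f : V -> R) : R :=
  sup [set `|f x| | x in [set x : V | `|x| <= 1]].

(* Only the values of F on the topological dual matter: F represents a
   functional on V', linear and bounded for the dual norm. *)
Definition topological_bidual (R : realType) (V : normedModType R) :
    set ((V -> R) -> R) :=
  [set F : (V -> R) -> R | (forall (a : R) (f g : V -> R),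
              topological_dual f -> topological_dual g ->
              F (fun x => a * f x + g x) = a * F f + F g)
         /\ (exists M : R, forall f : V -> R,
              topological_dual f -> `|F f| <= M * dual_norm f)].

(* The canonical embedding x |-> (f |-> f x) of V into V'' is onto. *)
Definition reflexive_space (R : realType) (V : normedModType R) : Prop :=
  forall F : (V -> R) -> R, topological_bidual F ->
    exists x : V, forall f : V -> R, topological_dual f -> F f = f x.

(* A functional with values in R U {+oo} is a function into \bar R that never
   takes the value -oo; on such functions the right-hand side below contains no
   undefined sum, and 0 * +oo = 0. *)
Definition convex_functional (R : realType) (V : lmodType R)
    (f : V -> \bar R) : Prop :=
  forall (x y : V) (t : R), 0 <= t <= 1 ->
    (f (t *: x + (1 - t) *: y)%R <= t%:E * f x + (1 - t)%:E * f y)%E.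

Definition proper_functional (R : realType) (V : Type) (f : V -> \bar R) :
    Prop :=
  (forall x, (-oo < f x)%E) /\ (exists x, (f x < +oo)%E).

Section generalized_constitutive_relation_error.
Context (R : realType) (H S : lmodType R).
Variables (calU : set H) (calT : set S) (B : H -> S -> R).
Variables (phi : H -> \bar R) (phis : S -> \bar R).
Local Open Scope ereal_scope.

Definition Psi (Uh : H) (Ph : S) : \bar R := phi Uh + phis Ph - (B Uh Ph)%:E.

Definition is_GCRE : Prop :=
  forall Uh Ph, calU Uh -> calT Ph -> 0 <= Psi Uh Ph.

Definition solution_pair (U : H) (P : S) : Prop :=
  [/\ calU U, calT P & Psi U P = 0].

Definition exact_solution_pair (U : H) (P : S) : Prop :=
  solution_pair U P /\
  forall U' P', solution_pair U' P' -> U' = U /\ P' = P.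

(* In both error functionals the subtracted term phi U, resp. phis P, is finite
   as soon as Psi U P = 0 and phi, phis never take the value -oo. *)
Definition error_phi (U : H) (P : S) (e : H) : \bar R :=
  phi (U + e)%R - phi U - (B e P)%:E.

Definition error_phis (U : H) (P : S) (r : S) : \bar R :=
  phis (P + r)%R - phis P - (B U r)%:E.

End generalized_constitutive_relation_error.

(* Main.v *)
Require Import Defs.
From mathcomp Require Import all_boot all_order all_algebra.
From mathcomp Require Import boolp classical_sets reals ereal convex.
From mathcomp Require Import topology normedtype.
From mathcomp Require Import lra.

Import Order.TTheory GRing.Theory Num.Theory.
Import numFieldNormedType.Exports.

Local Open Scope classical_set_scope.
Local Open Scope ring_scope.

(** Being bilinear, [B] equals its second-order expansion at [(U, P)] ([bilinear_increment]).
    Substituting this in [Psi] and subtracting [Psi U P = 0] cancels [B U P] against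
    [phi U + phis P]. The two first-order terms are those of the error functionals, and the mixed
    increment is left over. *)

Lemma bilinear_increment (R : realType) (H S : lmodType R)
    (B : {bilinear H -> S -> R | *%R & *%R}) (U V : H) (P Q : S) :
  B V Q = B U P + B (V - U) P + B U (Q - P) + B (V - U) (Q - P).
Proof. by rewrite !linearBl !linearBr; lra. Qed.

Theorem theorem3p2 (R : realType) (H S : completeNormedModType R)
    (reflH : reflexive_space H) (reflS : reflexive_space S)
    (calU : set H) (calT : set S)
    (closedU : closed calU) (convexU : @convex_set R H calU)
    (neU : calU !=set0)
    (closedT : closed calT) (convexT : @convex_set R S calT)
    (neT : calT !=set0)
    (B : {bilinear H -> S -> R | *%R & *%R})
    (contB : continuous (fun p : H * S => B p.1 p.2))
    (phi : H -> \bar R) (phis : S -> \bar R)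
    (convex_phi : convex_functional phi)
    (lsc_phi : lower_semicontinuous phi)
    (proper_phi : proper_functional phi)
    (convex_phis : convex_functional phis)
    (lsc_phis : lower_semicontinuous phis)
    (proper_phis : proper_functional phis)
    (gcre : is_GCRE calU calT B phi phis)
    (U : H) (P : S)
    (exactUP : exact_solution_pair calU calT B phi phis U P)
    (Uh : H) (Ph : S) (UhU : calU Uh) (PhT : calT Ph) :
  (Psi B phi phis Uh Ph =
   error_phi B phi U P (Uh - U)%R + error_phis B phis U P (Ph - P)%R
   - (B (Uh - U)%R (Ph - P)%R)%:E)%E.
Proof.
have [phiNy _] := proper_phi; have [phisNy _] := proper_phis.
have [[_ _ Psi0] _] := exactUP; move: Psi0.
(* The arguments [U + (Uh - U)] and [P + (Ph - P)] collapse to [Uh] and [Ph]. *)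
rewrite /Psi /error_phi /error_phis ![(_ + (_ - _))%R]addrC !subrK.
rewrite (bilinear_increment _ _ _ B U Uh P Ph).
(* [Psi U P = 0] rules out the value [+oo] for [phi U] and [phis P]. *)
move: (phiNy U) (phiNy Uh) (phisNy P) (phisNy Ph).
(* At [Uh] and [Ph] the value [+oo] may occur; both sides are then [+oo] by computation. *)
case: (phi U) => [a| |] // _; case: (phi Uh) => [b| |] // _;
  case: (phis P) => [c| |] // _; case: (phis Ph) => [d| |] // _ //.
(* All four values are real here, and [acB] is [Psi U P = 0] read in [R]. *)
by move=> [acB]; congr EFin; lra.
Qed.
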